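(* Consider the problem of maximizing $$\int_0^T\big[-\langle c,\rho^2(t)\rangle+\langle p(t),S(I(t),p(t))\rangle\big]\,\sigma(t)\,dt$$ over $(p,I,\rho)$ subject to $\frac{dI}{dt}=-S(I,p)\,\sigma+\rho^2\sigma$ and boundary constraints on $I(0)$, $I(T)$. Consider the two cases (CR) continuous replenishment: $\rho_i\ne0$ for all $i=1,\dots,n$; (MD) markdown: $\rho_i=0$ for all $i=1,\dots,n$. Then: (i) in both cases (CR) and (MD) the quantity $-\langle R,\Gamma^{-1}1_n\rangle$ is invariant (constant in time) on an optimal price/inventory trajectory; (ii) in case (CR) this quantity is equal to the total profit rate, i.e. $\langle p-c,S\rangle=-\langle R,\Gamma^{-1}1_n\rangle$.
   Context: There are $n$ items and a time interval $[0,T]$. $I(t)=(I_1,\dots,I_n)$ is inventory, $p(t)=(p_1,\dots,p_n)$ price, $S=S(I,p)=(S_1,\dots,S_n)$ the rate of sales (demand), a given function of inventory and price with no explicit time dependence, $R=pS$ the revenue rate, $c=(c_1,\dots,c_n)$, $c_i\ge0$, the constant unit cost, and $\rho^2=(\rho_1^2,\dots,\rho_n^2)$ the de-seasoned replenishment rate. $\sigma(t)$ is a known probability density on $[0,T]$. In case (MD) the problem is to maximize $\int_0^T\langle p,S(I,p)\rangle\sigma\,dt$ subject to $\frac{dI}{dt}=-S\sigma$, $I(0)=I_0$, $I(T)=0$. The conditions on $\rho$ in (CR) and (MD) hold at all times along the trajectory. Products and squares of vectors are componentwise; $\langle\cdot,\cdot\rangle$ is the standard scalar product; $1_n$ is the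 $n$-vector with all coordinates $1$. The cross-elasticity matrix is $\Gamma_{ij}=S_i^{-1}\frac{\partial S_i}{\partial p_j}p_j$, evaluated along the trajectory. Standing assumptions: all functions are sufficiently regular (differentiable); $I,p,S$ are positive along the trajectory (in the interior of the time interval); $\Gamma$ is invertible; and the Lagrange multiplier rule applies, i.e. an optimal trajectory admits a differentiable multiplier $\lambda(t)\in\mathbb R^n$ satisfying the Euler–Lagrange equations of the Lagrangian $L=-\langle c,\rho^2\rangle\sigma+\langle p,S\rangle\sigma+\langle\lambda,\tfrac{dI}{dt}+S\sigma-\rho^2\sigma\rangle$, namely $(c+\lambda)\rho=0$ (componentwise), $p+\lambda=-[(\partial S/\partial p)^T]^{-1}S$, and $\dot\lambda=\sigma(\partial S/\partial I)^T(p+\lambda)$. *)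

(* Defs.v *)
From HB Require Import structures.
From mathcomp Require Import all_boot all_order all_algebra.
From mathcomp Require Import all_classical all_reals all_analysis.
Import Order.TTheory GRing.Theory Num.Theory.
Import numFieldNormedType.Exports.

Set Implicit Arguments.
Unset Strict Implicit.
Unset Printing Implicit Defensive.

Local Open Scope classical_set_scope.
Local Open Scope ring_scope.

Section vectors.
Context {R : realType} {n : nat}.
Implicit Types u v : 'cV[R]_n.

Definition dotv u v : R := \sum_i u i 0 * v i 0.
Definition hmul u v : 'cV[R]_n := \col_i (u i 0 * v i 0).
Definition hsq v : 'cV[R]_n := hmul v v.
Definition posv v : Prop := forall i, 0 < v i 0.

End vectors.

(** Demand is written [S I p]: inventory first, price second. *)
Section demand.
Context {R : realType} {n : nat}.
Variables (S : 'cV[R]_n -> 'cV[R]_n -> 'cV[R]_n) (I p : 'cV[R]_n).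

Definition dSdp : 'M[R]_n :=
  \matrix_(i, j) 'D_(delta_mx j 0) (fun q : 'cV[R]_n => S I q i 0) p.

Definition dSdI : 'M[R]_n :=
  \matrix_(i, j) 'D_(delta_mx j 0) (fun J : 'cV[R]_n => S J p i 0) I.

Definition elasticity : 'M[R]_n :=
  \matrix_(i, j) ((S I p i 0)^-1 * dSdp i j * p j 0).

Definition revenue : 'cV[R]_n := hmul p (S I p).

(** - < R, Gamma^-1 1_n > *)
Definition invariant_rate : R :=
  - dotv revenue (invmx elasticity *m const_mx 1).

End demand.

Section problem.
Context {R : realType} {n : nat}.
Notation mu := (@lebesgue_measure R).
Notation vec := 'cV[R]_n.

Variables (T : R) (sigma : R -> R) (c : vec) (S : vec -> vec -> vec).
Implicit Types (p I rho lambda : R -> vec) (t : R).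

Definition density : Prop :=
  [/\ measurable_fun `[0, T] sigma,
      forall t, t \in `[0, T] -> 0 <= sigma t
    & (\int[mu]_(t in `[0%R, T]) (sigma t)%:E = 1)%E].

Definition differentiable_inside (f : R -> vec) : Prop :=
  forall t, t \in `]0, T[ -> derivable f t 1.

Definition profit_density p I rho t : R :=
  (- dotv c (hsq (rho t)) + dotv (p t) (S (I t) (p t))) * sigma t.

Definition profit p I rho : R :=
  \int[mu]_(t in `[0, T]) profit_density p I rho t.

(** [B (I 0) (I T)] is the boundary constraint.  The dynamics are imposed on
    the open interval; continuity of [I] on [0, T] makes the boundary values
    meaningful, and integrability does so for the objective. *)
Definition feasible (B : vec -> vec -> Prop) p I rho : Prop :=
  [/\ [/\ differentiable_inside p, differentiable_inside I,
          differentiable_inside rho & {within `[0, T], continuous I}],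
      forall t, t \in `]0, T[ ->
        derive1 I t = - (sigma t *: S (I t) (p t)) + sigma t *: hsq (rho t),
      B (I 0) (I T)
    & mu.-integrable `[0, T] (EFin \o profit_density p I rho)].

Definition optimal (B : vec -> vec -> Prop) p I rho : Prop :=
  feasible B p I rho /\
  forall p' I' rho', feasible B p' I' rho' ->
    profit p' I' rho' <= profit p I rho.

Definition sales_density p I t : R := dotv (p t) (S (I t) (p t)) * sigma t.

Definition sales p I : R := \int[mu]_(t in `[0, T]) sales_density p I t.

Definition md_feasible (I0 : vec) p I : Prop :=
  [/\ [/\ differentiable_inside p, differentiable_inside I
        & {within `[0, T], continuous I}],
      forall t, t \in `]0, T[ -> derive1 I t = - (sigma t *: S (I t) (p t)),
      I 0 = I0,
      I T = 0
    & mu.-integrable `[0, T] (EFin \o sales_density p I)].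

Definition md_optimal (I0 : vec) p I : Prop :=
  md_feasible I0 p I /\
  forall p' I', md_feasible I0 p' I' -> sales p' I' <= sales p I.

Definition interior_regular p I : Prop :=
  forall t, t \in `]0, T[ ->
    [/\ posv (I t), posv (p t), posv (S (I t) (p t))
      & elasticity S (I t) (p t) \in unitmx].

(** Stationarity in [rho], [p] and [I] of
    L = - <c, rho^2> sigma + <p, S> sigma
        + <lambda, dI/dt + S sigma - rho^2 sigma>. *)
Definition euler_lagrange p I rho lambda : Prop :=
  differentiable_inside lambda /\
  forall t, t \in `]0, T[ ->
    [/\ hmul (c + lambda t) (rho t) = 0,
        p t + lambda t =
          - (invmx (dSdp S (I t) (p t))^T *m S (I t) (p t))
      & derive1 lambda t =
          sigma t *: ((dSdI S (I t) (p t))^T *m (p t + lambda t))].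

Definition multiplier_rule (B : vec -> vec -> Prop) : Prop :=
  forall p I rho, optimal B p I rho -> interior_regular p I ->
    exists lambda, euler_lagrange p I rho lambda.

Definition md_multiplier_rule (I0 : vec) : Prop :=
  forall p I, md_optimal I0 p I -> interior_regular p I ->
    exists lambda, euler_lagrange p I (fun=> 0) lambda.

Definition replenished rho : Prop :=
  forall t, t \in `]0, T[ -> forall i, rho t i 0 != 0.

Definition marked_down rho : Prop :=
  forall t, t \in `]0, T[ -> forall i, rho t i 0 = 0.

(** The endpoints are excluded: [S], hence [elasticity], may degenerate
    there, e.g. when [I T = 0]. *)
Definition constant_inside (f : R -> R) : Prop :=
  exists k, forall t, t \in `]0, T[ -> f t = k.

End problem.

(* Main.v *)
Require Import Defs.
From HB Require Import structures.
From mathcomp Require Import all_boot all_order all_algebra.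
From mathcomp Require Import lra.
From mathcomp Require Import all_classical all_reals all_analysis.
Import Order.TTheory GRing.Theory Num.Theory.
Import numFieldNormedType.Exports.

Local Open Scope classical_set_scope.
Local Open Scope ring_scope.

(** Since Gamma = diag(S)^-1 (dS/dp) diag(p), the vector Gamma^-1 1_n is
    diag(p)^-1 (dS/dp)^-1 S, so stationarity in p identifies
    - < R, Gamma^-1 1_n > with < p + lambda, S >.  Along a stationary
    trajectory the derivative of the latter is < lambda', rho^2 >, which
    vanishes when rho = 0, and also when no rho_i vanishes, because then
    lambda = - c. *)

(** * Bilinearity and adjoints for the scalar product *)

Section scalar_product.
Context {R : realType} {n : nat}.
Implicit Types u v w : 'cV[R]_n.

Lemma dotvE u v : dotv u v = (u^T *m v) 0 0.
Proof. by rewrite mxE; apply: eq_bigr => i _; rewrite mxE. Qed.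

Lemma dotvC u v : dotv u v = dotv v u.
Proof. by apply: eq_bigr => i _; rewrite mulrC. Qed.

Lemma dotvDr u v w : dotv u (v + w) = dotv u v + dotv u w.
Proof. by rewrite !dotvE mulmxDr mxE. Qed.

Lemma dotvNr u v : dotv u (- v) = - dotv u v.
Proof. by rewrite !dotvE mulmxN mxE. Qed.

Lemma dotvNl u v : dotv (- u) v = - dotv u v.
Proof. by rewrite dotvC dotvNr dotvC. Qed.

Lemma dotvZr k u v : dotv u (k *: v) = k * dotv u v.
Proof. by rewrite !dotvE -scalemxAr mxE. Qed.

Lemma dotvZl k u v : dotv (k *: u) v = k * dotv u v.
Proof. by rewrite dotvC dotvZr dotvC. Qed.

Lemma dotv0l v : dotv 0 v = 0.
Proof. by rewrite dotvE trmx0 mul0mx mxE. Qed.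

Lemma dotv_mulmxr u (A : 'M[R]_n) v : dotv u (A *m v) = dotv (A^T *m u) v.
Proof. by rewrite !dotvE trmx_mul trmxK mulmxA. Qed.

End scalar_product.

(** * Inverting the cross-elasticity matrix *)

Section elasticity_form.
Context {R : realType} {n : nat}.
Variables (S : 'cV[R]_n -> 'cV[R]_n -> 'cV[R]_n) (I p : 'cV[R]_n).
Hypothesis elasticity_unit : elasticity S I p \in unitmx.

Lemma elasticity_diag : elasticity S I p =
  diag_mx (\row_i (S I p i 0)^-1) *m dSdp S I p *m diag_mx p^T.
Proof.
by apply/matrixP => i j; rewrite mul_mx_diag mxE mul_diag_mx !mxE.
Qed.

(** A product of square matrices is invertible only if each factor is, and dS/dp is the middle
    factor in [elasticity_diag]. *)
Lemma dSdp_unit : dSdp S I p \in unitmx.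
Proof.
by move: elasticity_unit; rewrite elasticity_diag !unitmx_mul => /andP[/andP[]].
Qed.

Lemma invmx_elasticity1 : posv p -> posv (S I p) ->
  invmx (elasticity S I p) *m const_mx 1 =
  \col_i ((p i 0)^-1 * (invmx (dSdp S I p) *m S I p) i 0).
Proof.
move=> p_gt0 S_gt0; set A := dSdp S I p; set y := \col_i _.
have py : diag_mx p^T *m y = invmx A *m S I p.
  apply/colP => i; rewrite mul_diag_mx !mxE mulVKf//.
  by rewrite gt_eqF.
(* Writing [y] as Gamma^-1 (Gamma y) leaves Gamma y = 1_n to check, one factor of Gamma at a
   time. *)
rewrite -(mulKmx elasticity_unit y) elasticity_diag -!mulmxA py.
congr (_ *m _); rewrite mulKVmx; last exact: dSdp_unit.
by apply/colP => i; rewrite mul_diag_mx !mxE mulVf// gt_eqF.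
Qed.

(** Each p_i in the revenue cancels the p_i^-1 in Gamma^-1 1_n, leaving - < S, (dS/dp)^-1 S >. The
    adjoint then produces the vector that stationarity in [p] equates with p + lambda. *)
Lemma invariant_rateE : posv p -> posv (S I p) ->
  invariant_rate S I p =
  dotv (- (invmx (dSdp S I p)^T *m S I p)) (S I p).
Proof.
move=> p_gt0 S_gt0; rewrite /invariant_rate invmx_elasticity1// dotvNl.
congr (- _); rewrite -trmx_inv -dotv_mulmxr; apply: eq_bigr => i _.
rewrite !mxE mulrACA mulfV ?gt_eqF//.
by rewrite mul1r.
Qed.

End elasticity_form.

(** * Product rule, chain rule, and constancy from a zero derivative *)

Section differentiation.
Context {R : realType}.

Lemma is_derive_dotv n (u v : R -> 'cV[R]_n) (du dv : 'cV[R]_n) (t : R) :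
  is_derive t 1 u du -> is_derive t 1 v dv ->
  is_derive t 1 (fun s => dotv (u s) (v s)) (dotv du (v t) + dotv (u t) dv).
Proof.
have coord (w : R -> 'cV[R]_n) dw i : is_derive t 1 w dw ->
    is_derive t 1 (fun s => w s i 0) (dw i 0).
  move=> [w_der <-]; split; first exact: (derivable_mxP _ _ _).1.
  by rewrite derive_mx// mxE.
move=> du_t dv_t.
pose h i : R -> R := (fun s => u s i 0) * (fun s => v s i 0).
have -> : (fun s => dotv (u s) (v s)) = \sum_(i < n) h i.
  by apply/funext => s; rewrite fct_sumE.
have h_der i : is_derive t 1 (h i) (u t i 0 *: dv i 0 + v t i 0 *: du i 0).
  exact: is_deriveM (coord _ _ _ du_t) (coord _ _ _ dv_t).
apply: is_derive_eq (is_derive_sum h_der) _.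
rewrite big_split /= addrC; congr (_ + _).
by apply: eq_bigr => i _; rewrite [LHS]mulrC.
Qed.

(** Expand [v] in the canonical basis and use linearity. For [g] a partial map of [S], the matrix is
    [dSdI] or [dSdp]. *)
Lemma diff_mulmx m n (g : 'cV[R]_n -> 'cV[R]_m) (a v : 'cV[R]_n) :
  differentiable g a ->
  'd g a v =
  (\matrix_(i, j) 'D_(delta_mx j 0) (fun q => g q i 0) a) *m v.
Proof.
move=> g_diff; rewrite {1}(matrix_sum_delta v) linear_sum; apply/colP => i.
rewrite summxE mxE; apply: eq_bigr => j _; rewrite big_ord1 linearZ !mxE mulrC.
by congr (_ * _); rewrite -deriveE// derive_mx ?mxE//; exact: diff_derivable.
Qed.

Lemma is_derive_demand n (S : 'cV[R]_n -> 'cV[R]_n -> 'cV[R]_n)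
    (I p : R -> 'cV[R]_n) (dI dp : 'cV[R]_n) (t : R) :
  differentiable (fun x : 'cV[R]_n * 'cV[R]_n => S x.1 x.2) (I t, p t) ->
  is_derive t 1 I dI -> is_derive t 1 p dp ->
  is_derive t 1 (fun s => S (I s) (p s))
    (dSdI S (I t) (p t) *m dI + dSdp S (I t) (p t) *m dp).
Proof.
set F := fun x => _ => F_diff [I_der <-] [p_der <-].
have I_diff : differentiable I t by exact: (derivable1_diffP _ _).1 I_der.
have p_diff : differentiable p t by exact: (derivable1_diffP _ _).1 p_der.
have Ip_diff := differentiable_pair I_diff p_diff.
(* Composing the joint map [F] with these two affine slices isolates the two blocks of its
   differential; [diff_val] picks up both facts as instances. *)
have fst_diff : is_diff (I t) (fun J => (J, p t)) (fun v => (v, 0)).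
  exact: is_diff_pair.
have snd_diff : is_diff (p t) (fun q => (I t, q)) (fun v => (0, v)).
  exact: is_diff_pair.
have dF1 v : 'd F (I t, p t) (v, 0) = dSdI S (I t) (p t) *m v.
  rewrite -(@diff_mulmx _ _ (fun J => S J (p t))).
    by rewrite (@diff_comp _ _ _ _ (fun J => (J, p t)) F)//= diff_val.
  exact: (@differentiable_comp _ _ _ _ (fun J => (J, p t)) F).
have dF2 v : 'd F (I t, p t) (0, v) = dSdp S (I t) (p t) *m v.
  rewrite -(@diff_mulmx _ _ (fun q => S (I t) q)).
    by rewrite (@diff_comp _ _ _ _ (fun q => (I t, q)) F)//= diff_val.
  exact: (@differentiable_comp _ _ _ _ (fun q => (I t, q)) F).
have S_diff := @differentiable_comp _ _ _ _ (fun s => (I s, p s)) F t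
  Ip_diff F_diff.
split; first exact/derivable1_diffP.
rewrite deriveE// (@diff_comp _ _ _ _ (fun s => (I s, p s)) F)//=.
(* The velocity splits as (I', p') = (I', 0) + (0, p'). *)
rewrite diff_pair// !deriveE// -dF1 -dF2 -linearD; congr ('d F _ _).
by congr pair; rewrite ?addr0 ?add0r.
Qed.

(** The mean value theorem is applied on closed subintervals of ]0, T[, so the endpoints 0 and T are
    never reached. *)
Lemma constant_inside_derive (T : R) (f : R -> R) :
  0 < T -> (forall t, t \in `]0, T[ -> is_derive t (1 : R) f 0) ->
  constant_inside T f.
Proof.
move=> T_gt0 f_der.
have le_cst x y : x \in `]0, T[ -> y \in `]0, T[ -> x <= y -> f x = f y.
  move=> xT yT xy.
  have sub z : z \in `[x, y] -> z \in `]0, T[.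
    rewrite !in_itv/= => /andP[xz zy]; move: xT yT; rewrite !in_itv/=.
    move=> /andP[x_gt0 _] /andP[_ y_ltT].
    by rewrite (lt_le_trans x_gt0 xz) (le_lt_trans zy y_ltT).
  have f_xy : {within `[x, y], continuous f}.
    by apply: derivable_within_continuous => z /sub/f_der [].
  have f_der_xy z : z \in `]x, y[ -> is_derive z 1 f 0.
    by move=> zxy; apply/f_der/sub; exact: subset_itv_oo_cc.
  have [z _] := @MVT_segment R f (cst 0) x y xy f_der_xy f_xy.
  by rewrite mul0r => /subr0_eq.
(* The midpoint is the reference point: the constant is the value of [f] there. *)
have mid : T / 2 \in `]0, T[.
  by rewrite in_itv/= divr_gt0// ltr_pdivrMr// ltr_pMr// ltr1n.
exists (f (T / 2)) => t tT.
by have [le_t|/ltW le_t] := leP t (T / 2); [|apply/esym]; exact: le_cst.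
Qed.

End differentiation.

(** * Trajectories satisfying the Euler-Lagrange equations *)

Section stationary_trajectory.
Context {R : realType} {n : nat}.
Variables (T : R) (sigma : R -> R) (c : 'cV[R]_n).
Variables (S : 'cV[R]_n -> 'cV[R]_n -> 'cV[R]_n).
Variables (p I rho lambda : R -> 'cV[R]_n).
Hypothesis T_gt0 : 0 < T.
Hypothesis S_diff : forall J q : 'cV[R]_n, posv J -> posv q ->
  differentiable (fun x : 'cV[R]_n * 'cV[R]_n => S x.1 x.2) (J, q).
Hypothesis p_diff : differentiable_inside T p.
Hypothesis I_diff : differentiable_inside T I.
Hypothesis dynamics : forall t, t \in `]0, T[ ->
  derive1 I t = - (sigma t *: S (I t) (p t)) + sigma t *: hsq (rho t).
Hypothesis regular : interior_regular T S p I.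
Hypothesis stationary : euler_lagrange T sigma c S p I rho lambda.

(** This is the profit rate with the unit cost [c] replaced by the shadow price - lambda of
    inventory. *)
Let rate t := dotv (p t + lambda t) (S (I t) (p t)).

Lemma invariant_rate_shadow t : t \in `]0, T[ ->
  invariant_rate S (I t) (p t) = rate t.
Proof.
move=> tT; have [_ p_gt0 S_gt0 G_unit] := regular t tT.
by rewrite invariant_rateE// /rate; have [_ ->] := stationary.2 t tT.
Qed.

(* The price term [<p + lambda, (dS/dp) p'>] cancels [<p', S>]; since
   [sigma (dS/dI)^T (p + lambda) = lambda'], the sales part of [I'] cancels
   [<lambda', S>], and only replenishment remains. *)
Lemma is_derive_rate t : t \in `]0, T[ ->
  is_derive t 1 rate (dotv (derive1 lambda t) (hsq (rho t))).
Proof.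
move=> tT; have [I_gt0 p_gt0 S_gt0 G_unit] := regular t tT.
have [_ pl l'] := stationary.2 t tT.
have dp := derivableP (p_diff t tT).
have dI := derivableP (I_diff t tT).
have dl := derivableP (stationary.1 t tT).
have dS := is_derive_demand _ _ _ _ _ _ _ (S_diff _ _ I_gt0 p_gt0) dI dp.
have dpl : is_derive t 1 (fun s => p s + lambda s) _ := is_deriveD dp dl.
apply: (is_derive_eq (is_derive_dotv _ _ _ _ _ _ dpl dS)).
rewrite /= -!derive1E !dotvDr !dotv_mulmxr.
have -> : (dSdp S (I t) (p t))^T *m (p t + lambda t) = - S (I t) (p t).
  by rewrite pl mulmxN mulKVmx// unitmx_tr dSdp_unit.
rewrite dynamics// dotvDr dotvNr !dotvZr -!dotvZl -l' dotvNl.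
rewrite [dotv (_ + _) _]dotvC dotvDr ![dotv (S _ _) _]dotvC.
lra.
Qed.

(** Stationarity in [rho] reads (c_i + lambda_i) rho_i = 0, and the nonzero rho_i cancels. *)
Lemma replenished_multiplier t : replenished T rho -> t \in `]0, T[ ->
  lambda t = - c.
Proof.
move=> rho_neq0 tT; have [cl _ _] := stationary.2 t tT.
apply/eqP; rewrite -addr_eq0 addrC; apply/eqP/colP => i.
move/colP/(_ i): cl => /eqP; rewrite !mxE mulf_eq0 (negPf (rho_neq0 t tT i)).
by rewrite orbF => /eqP.
Qed.

Lemma invariant_rate_constant : replenished T rho \/ marked_down T rho ->
  constant_inside T (fun t => invariant_rate S (I t) (p t)).
Proof.
move=> cases; have [|k rate_k] := @constant_inside_derive R T rate T_gt0.
  move=> t tT; apply: (is_derive_eq (is_derive_rate t tT)).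
  case: cases => [CR|MD]; last first.
    rewrite (_ : hsq _ = 0) ?dotvE ?mulmx0 ?mxE//.
    by apply/colP => i; rewrite !mxE MD// mul0r.
  suff -> : derive1 lambda t = 0 by rewrite dotv0l.
  (* The equality lambda = - c is known on ]0, T[, which is a neighbourhood of [t]; that suffices
     for the derivative. *)
  rewrite derive1E -(derive_cst (- c) t (1 : R)); apply: near_eq_derive => //.
  have : \forall s \near t, s \in `]0, T[ by exact: near_in_itvoo.
  by apply: filterS => s /(replenished_multiplier s CR).
by exists k => t tT; rewrite invariant_rate_shadow// rate_k.
Qed.

Lemma replenished_profit_rate t : replenished T rho -> t \in `]0, T[ ->
  dotv (p t - c) (S (I t) (p t)) = invariant_rate S (I t) (p t).
Proof.
by move=> CR tT; rewrite invariant_rate_shadow// /rate replenished_multiplier.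
Qed.

End stationary_trajectory.

(** * From optimal to stationary trajectories *)

Theorem corollary2 (R : realType) (n : nat) (T : R) (sigma : R -> R)
    (c : 'cV[R]_n) (S : 'cV[R]_n -> 'cV[R]_n -> 'cV[R]_n)
    (T_gt0 : 0 < T) (sigma_density : density T sigma)
    (c_ge0 : forall i, 0 <= c i 0)
    (S_diff : forall I p : 'cV[R]_n, posv I -> posv p ->
       differentiable (fun x : 'cV[R]_n * 'cV[R]_n => S x.1 x.2) (I, p)) :
  (forall (B : 'cV[R]_n -> 'cV[R]_n -> Prop) (p I rho : R -> 'cV[R]_n),
     multiplier_rule T sigma c S B ->
     optimal T sigma c S B p I rho ->
     interior_regular T S p I ->
     (replenished T rho \/ marked_down T rho ->
        constant_inside T (fun t => invariant_rate S (I t) (p t))) /\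
     (replenished T rho ->
        forall t, t \in `]0, T[ ->
          dotv (p t - c) (S (I t) (p t)) = invariant_rate S (I t) (p t))) /\
  (forall (I0 : 'cV[R]_n) (p I : R -> 'cV[R]_n),
     md_multiplier_rule T sigma c S I0 ->
     md_optimal T sigma S I0 p I ->
     interior_regular T S p I ->
     constant_inside T (fun t => invariant_rate S (I t) (p t))).
Proof.
split=> [B p I rho mult opt reg|I0 p I mult opt reg].
  have [lambda EL] := mult _ _ _ opt reg.
  have [[p_diff I_diff _ _] dyn _ _] := opt.1.
  split; first exact: (invariant_rate_constant T sigma c S p I rho lambda).
  by move=> CR t; exact: (replenished_profit_rate T sigma c S p I rho lambda).
have [lambda EL] := mult _ _ opt reg.
have [[p_diff I_diff _] dyn _ _ _] := opt.1.
(* The markdown problem is read as the replenishment dynamics with rho = 0, whose extra term sigma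
   rho^2 vanishes. *)
apply: (invariant_rate_constant T sigma c S p I (fun=> 0) lambda) => //.
  move=> t tT; rewrite dyn// (_ : hsq _ = 0) ?scaler0 ?addr0//.
  by apply/colP => i; rewrite !mxE mul0r.
by right=> t _ i; rewrite mxE.
Qed.
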